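(* Let $D$ be an oriented virtual knot diagram and let $c$ be a classical crossing of $D$. Then the virtual index $vInd_D(c)$ and the index $Ind_D(c)$ coincide: $vInd_D(c)=Ind_D(c)$.
   Context: An oriented virtual knot diagram $D$ is a generic immersion of one oriented circle into the oriented plane, each transversal double point being marked classical (with over/under information) or virtual. At a classical crossing $c$ name the two strands $a,b$ so that (direction of $a$, direction of $b$) is a positive frame. $\operatorname{sign}(c)=+1$ if (direction of over-strand, direction of under-strand) is a positive frame, and $-1$ otherwise. The left half $D^l_c$ is the closed path in $D$ that leaves $c$ along the outgoing edge of $b$ and follows $D$ until it returns to $c$ along the incoming edge of $a$. The right half $D^r_c$ is the complementary closed path (leaving along the outgoing edge of $a$, returning along the incoming edge of $b$). Put $D^+_c=D^l_c$ if $\operatorname{sign}(c)=+1$ and $D^+_c=D^r_c$ if $\operatorname{sign}(c)=-1$. Virtual index: $vInd_D(c)$ is the sum over all passages of $D^+_c$ through virtual crossings of $D$ of $+1$ if the other strand crosses from right to left and $-1$ if it crosses from left to right (a virtual self-crossing of $D^+_c$ is counted at both passages). Index: $Ind_D(c)$ is the sum over all passages of $D^+_c$ through classical crossings $c'\neq c$ of $D$ of the intersection number, equal to $+1$ if the other strand crosses from left to right and $-1$ if it crosses from right to left. Equivalently, the intersection number is $-\operatorname{sign}(c')$ if $D^+_c$ passes over at $c'$ and $+\operatorname{sign}(c')$ if it passes under. *)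

(* Defs.v *)
From HB Require Import structures.
From mathcomp Require Import all_boot all_order all_algebra.
From mathcomp Require Import all_classical all_reals all_analysis.

Set Implicit Arguments.
Unset Strict Implicit.
Unset Printing Implicit Defensive.

Import Order.TTheory GRing.Theory Num.Theory.
Import numFieldNormedType.Exports.

Local Open Scope classical_set_scope.
Local Open Scope ring_scope.

(* (u, v) is a positive frame of the oriented plane iff 0 < det2 u v; a strand
   of direction v then crosses a strand of direction u from the right of u to
   its left. *)
Definition det2 (R : realType) (u v : R * R) : R := u.1 * v.2 - u.2 * v.1.

Inductive strand_kind := Over | Under | Virt.

Definition opposite_kind (k : strand_kind) : strand_kind :=
  match k with Over => Under | Under => Over | Virt => Virt end.

(* The oriented circle is R/Z with increasing parameter, so a closed curve is a
   1-periodic map; each point of the circle is represented once in [0, 1[. *)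
Definition circle_pt (R : realType) (t : R) : Prop := 0 <= t < 1.

(* A passage through a double point: the first parameter is the strand being
   followed, the second one is the other strand. Every double point thus gives
   two passages, (s, t) and (t, s). *)
Definition passages_of (R : realType) (g : R -> R * R) : set (R * R) :=
  [set p | [/\ circle_pt p.1, circle_pt p.2, p.1 <> p.2 & g p.1 = g p.2]].

(* [mark t] is the kind of the strand at parameter t; only its values at the
   preimages in [0, 1[ of the double points matter. *)
Record virtual_knot_diagram (R : realType) := VirtualKnotDiagram {
  curve : R -> R * R;
  mark : R -> strand_kind;
  curve_periodic : forall t : R, curve (t + 1) = curve t;
  curve_derivable : forall t : R, derivable curve t 1;
  curve_C1 : continuous (derive1 curve);
  curve_immersion : forall t : R, derive1 curve t <> 0;
  curve_no_triple : forall s t u : R,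
    circle_pt s -> circle_pt t -> circle_pt u ->
    curve s = curve t -> curve t = curve u -> [\/ s = t, t = u | s = u];
  curve_transversal : forall s t : R, passages_of curve (s, t) ->
    det2 (derive1 curve s) (derive1 curve t) <> 0;
  curve_finite : finite_set (passages_of curve);
  mark_opposite : forall s t : R, passages_of curve (s, t) ->
    mark t = opposite_kind (mark s)
}.

Section Diagram.
Variables (R : realType) (D : virtual_knot_diagram R).

Definition dir (t : R) : R * R := derive1 (curve D) t.

Definition passages : set (R * R) := passages_of (curve D).

(* By transversality, exactly one of the two orders of the strands of a
   classical double point satisfies the frame condition. *)
Record classical_crossing := ClassicalCrossing {
  strand_a : R;
  strand_b : R;
  crossing_passage : passages (strand_a, strand_b);
  crossing_classical : mark D strand_a <> Virt;
  crossing_frame : 0 < det2 (dir strand_a) (dir strand_b)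
}.

Definition over_strand (c : classical_crossing) : R :=
  if mark D (strand_a c) is Over then strand_a c else strand_b c.

Definition under_strand (c : classical_crossing) : R :=
  if mark D (strand_a c) is Over then strand_b c else strand_a c.

Definition crossing_sign (c : classical_crossing) : int :=
  if 0 < det2 (dir (over_strand c)) (dir (under_strand c)) then 1 else -1.

(* For s <> t, the arc of the oriented circle from s to t, with endpoints; it
   runs through the base point 0 = 1 when t < s. *)
Definition arc (s t : R) : set R :=
  [set u | circle_pt u /\
           (if s < t then s <= u /\ u <= t else s <= u \/ u <= t)].

Definition left_half (c : classical_crossing) : set R :=
  arc (strand_b c) (strand_a c).

Definition right_half (c : classical_crossing) : set R :=
  arc (strand_a c) (strand_b c).

Definition half_plus (c : classical_crossing) : set R :=
  if crossing_sign c == 1 then left_half c else right_half c.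

Definition virtual_passages (c : classical_crossing) : set (R * R) :=
  [set p | [/\ passages p, half_plus c p.1 & mark D p.1 = Virt]].

Definition classical_passages (c : classical_crossing) : set (R * R) :=
  [set p | [/\ passages p, half_plus c p.1, mark D p.1 <> Virt &
               curve D p.1 <> curve D (strand_a c)]].

Definition right_to_left (p : R * R) : bool := 0 < det2 (dir p.1) (dir p.2).

Definition left_to_right (p : R * R) : bool := det2 (dir p.1) (dir p.2) < 0.

Definition virtual_number (p : R * R) : int :=
  if right_to_left p then 1 else -1.

Definition intersection_number (p : R * R) : int :=
  if left_to_right p then 1 else -1.

(* These sums range over finite sets, by [curve_finite]. *)
Definition vInd (c : classical_crossing) : int :=
  \sum_(p \in virtual_passages c) virtual_number p.

Definition Ind (c : classical_crossing) : int :=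
  \sum_(p \in classical_passages c) intersection_number p.

End Diagram.

(* Main.v *)
Require Import Defs.
From mathcomp Require Import all_boot all_order all_algebra.
From mathcomp Require Import all_classical all_reals all_analysis.
From mathcomp Require Import zify ring lra.

Set Implicit Arguments.
Unset Strict Implicit.
Unset Printing Implicit Defensive.

Import Order.TTheory GRing.Theory Num.Theory.
Import numFieldNormedType.Exports.

Local Open Scope classical_set_scope.
Local Open Scope ring_scope.

(** At every passage the two kinds of sums count the same thing up to sign:
    the virtual index adds the frame sign of (strand followed, other strand),
    the index subtracts it. So [vInd c - Ind c] is the sum of the frame signs
    over all passages of the half [half_plus c], virtual or classical, away
    from [c] ([vInd_sub_Ind]). A double point where the half meets itself is
    passed twice with opposite signs, so only the double points of the half
    with the complementary half remain, and the claim is that two closed plane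
    curves, which here share the point [c] without crossing there after
    smoothing, have algebraic intersection number zero
    ([closed_arcs_intersection_sum]).

    That topological fact is proved by winding numbers. Let the first curve be
    the arc of [g] over [[p, q]] and the second one the arc over [[q, p + 1]],
    with [g p = g q]. Inscribe in the second arc a closed polygon so fine that
    its chords meet the first arc only at common points of the two arcs, all of
    which are vertices ([inscribed_polygon]). As [s] runs from [p] to [q], the
    winding number of the polygon about [g s] is constant except at the common
    points, where it jumps by minus the frame sign ([side_winding_jump]).
    At the ends [s = p] and [s = q] the point [g s] sits on the polygon, at
    the vertex [c]; leaving [c] along the first arc and arriving back at [c]
    happens within one of the angular sectors cut out by the second arc, so both
    one-sided limits of the winding number agree ([side_winding_corner]). Hence the jumps
    add up to zero.

    Winding numbers of polygons are integers counted combinatorially: [turn u v]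
    is the signed number of times that the segment from [u] to [v] crosses the
    ray of the positive first axis. The only property needed is that [turn] is
    a coboundary on every open half plane ([turn_coboundary]), so a closed chain
    of vectors lying in one half plane has total turn zero. All open
    half planes are written as [0 < det2 w _].

    The curve enters through its continuity and through [secant_side]: a secant
    leaving a point lies in any given open half plane that contains the
    tangent vector, as soon as it is short. Compactness arguments
    are all instances of [interval_induction]. *)

(** * Half planes and signed ray crossings *)

Section PlaneAlgebra.
Variable R : realType.
Implicit Types u v w : R * R.

Lemma det2C u v : det2 v u = - det2 u v.
Proof. rewrite /det2; ring. Qed.

Definition frame_sign u v : int := if 0 < det2 u v then 1 else -1.

Lemma frame_signC u v : det2 u v != 0 -> frame_sign v u = - frame_sign u v.
Proof. by rewrite /frame_sign (det2C u v) oppr_gt0; case: ltgtP. Qed.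

Lemma det2D w u v : det2 w (u + v) = det2 w u + det2 w v.
Proof. rewrite /det2 /=; ring. Qed.

Lemma det2B w u v : det2 w (u - v) = det2 w u - det2 w v.
Proof. rewrite /det2 /=; ring. Qed.

Lemma det2Z w k u : det2 w (k *: u) = k * det2 w u.
Proof. rewrite /det2 /= /GRing.scale /=; ring. Qed.

Lemma det2ZZ k l u v : det2 (k *: u) (l *: v) = k * l * det2 u v.
Proof. by rewrite det2Z det2C det2Z (det2C u); ring. Qed.

Lemma det2Nl w u : det2 (- w) u = - det2 w u.
Proof. rewrite /det2 /=; ring. Qed.

Lemma det2r0 w : det2 w 0 = 0.
Proof. rewrite /det2 /=; ring. Qed.

Lemma det2_gt0_neq0 w u : 0 < det2 w u -> u <> 0.
Proof. by move=> H E; move: H; rewrite E det2r0 ltxx. Qed.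

Lemma half_plane_nonzero u : u <> 0 -> exists w, 0 < det2 w u.
Proof.
move=> u0; exists (u.2, - u.1); rewrite /det2 /=.
have -> : u.2 * u.2 - - u.1 * u.1 = u.1 ^+ 2 + u.2 ^+ 2 by ring.
rewrite lt_neqAle addr_ge0 ?sqr_ge0 // andbT eq_sym paddr_eq0 ?sqr_ge0 //.
rewrite !sqrf_eq0; apply/negP => /andP[/eqP E1 /eqP E2].
by apply: u0; case: u E1 E2 => /= a b -> ->.
Qed.

Lemma half_plane_independent u v :
  det2 u v <> 0 -> exists w, 0 < det2 w u /\ 0 < det2 w v.
Proof.
move=> /eqP d0.
exists (- Num.sg (det2 u v) *: (v - u)).
have E x : det2 (- Num.sg (det2 u v) *: (v - u)) x
           = Num.sg (det2 u v) * (det2 u x - det2 v x).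
  by rewrite /det2 /= /GRing.scale /=; ring.
have E1 x : det2 x x = 0 by rewrite /det2; ring.
by rewrite !E !E1 (det2C u v) sub0r opprK subr0 -normrEsg normr_gt0.
Qed.

(** Vectors on the axis count as lying on its upper side, which makes the count
    an exact antisymmetric cochain without any genericity assumption. *)
Definition turn u v : int :=
  if (u.2 < 0) && (0 <= v.2) && (0 < det2 u v) then 1
  else if (0 <= u.2) && (v.2 < 0) && (det2 u v < 0) then -1 else 0.

Lemma turnC u v : turn v u = - turn u v.
Proof.
rewrite /turn (det2C u v) !oppr_gt0 !oppr_lt0.
by case: (ltP u.2 0) => a; case: (ltP v.2 0) => b; rewrite ?andbF //=;
  case: ifP.
Qed.

(** In a half plane that contains the positive first axis every change of side
    is a ray crossing, so the side itself is a potential; in any other half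
    plane no segment meets the ray. *)
Lemma turn_coboundary w : exists h : R * R -> int, forall u v,
  0 < det2 w u -> 0 < det2 w v -> turn u v = h v - h u.
Proof.
exists (fun u => if (w.2 < 0) && (0 <= u.2) then 1 else 0) => u v.
rewrite /turn.
have E : - w.2 * det2 u v = - u.2 * det2 w v + v.2 * det2 w u.
  by rewrite /det2; ring.
move=> Hu Hv.
case: (ltP u.2 0) => a; case: (ltP v.2 0) => b; rewrite ?andbF ?andbT //=.
- case: (ltP w.2 0) => c; case: ifP => //= d.
  + by move/negP: d; case; nra.
  + exfalso; nra.
- case: (ltP w.2 0) => c; case: ifP => //= d.
  + by move/negP: d; case; nra.
  + exfalso; nra.
- by rewrite subrr.
Qed.

Lemma turn_chain w u v x : 0 < det2 w u -> 0 < det2 w v -> 0 < det2 w x ->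
  turn u x = turn u v + turn v x.
Proof.
move=> Hu Hv Hx; have [h Hh] := turn_coboundary w.
by rewrite !Hh //; ring.
Qed.

(** The four directions [u], [- v], [- u], [v] go once around the origin, in the
    sense opposite to the frame (u, v). This is the jump of the
    winding number when a point crosses a strand of direction [v] while
    moving in the direction [u]. *)
Lemma turn_full u v : det2 u v <> 0 ->
  (turn u (- v) - turn (- u) (- v)) + (turn v u - turn v (- u))
  = - frame_sign u v.
Proof.
move=> /eqP d0; rewrite /turn /frame_sign /=.
have -> : det2 u (- v) = - det2 u v by rewrite /det2 /=; ring.
have -> : det2 (- u) (- v) = det2 u v by rewrite /det2 /=; ring.
have -> : det2 v u = - det2 u v by rewrite /det2 /=; ring.
have -> : det2 v (- u) = det2 u v by rewrite /det2 /=; ring.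
rewrite !oppr_gt0 !oppr_lt0 !oppr_ge0.
have Z : ~ (u.2 = 0 /\ v.2 = 0).
  by move=> [E1 E2]; move/eqP: d0; apply; rewrite /det2 E1 E2; ring.
case: (ltgtP (det2 u v) 0) d0 => // d _;
case: (ltgtP u.2 0) => a; case: (ltgtP v.2 0) => b //=; by case: Z.
Qed.

End PlaneAlgebra.

(** * Compactness of intervals and short secants *)

Section RealAnalysis.
Variable R : realType.

(** The supremum of the [x] with [P a x] is reached by the leftward hypothesis
    and can be exceeded by the rightward one unless it is [b]. This replaces
    covering arguments: [P u v] will say that some uniform bound, some
    polygon or some formula exists over the segment from [u] to [v]. *)
Lemma interval_induction (P : R -> R -> Prop) (a b : R) : a < b ->
  (forall u v w, a <= u -> u < v -> v < w -> w <= b ->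
     P u v -> P v w -> P u w) ->
  (forall x, a <= x -> x < b -> exists2 r, 0 < r &
     forall y, x < y -> y < x + r -> y < b -> P x y) ->
  (forall x, a < x -> x <= b -> exists2 r, 0 < r &
     forall y, x - r < y -> y < x -> a < y -> P y x) ->
  P a b.
Proof.
move=> ab Ptrans Pr Pl.
have Pr' x : a <= x -> x < b -> exists2 y, x < y < b & P x y.
  move=> ax xb; have [r r0 H] := Pr x ax xb.
  pose m := Num.min (r / 2) ((b - x) / 2).
  have m0 : 0 < m by rewrite lt_min; apply/andP; split; lra.
  have mr : m <= r / 2 by rewrite ge_min lexx.
  have mb : m <= (b - x) / 2 by rewrite ge_min lexx orbT.
  by exists (x + m); [apply/andP; split; lra | apply: H; lra].
pose S := [set x | a < x <= b /\ P a x].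
have [y0 /andP[ay0 y0b] Py0] := Pr' a (lexx a) ab.
have Sy0 : S y0 by split => //; apply/andP; split => //; exact: ltW.
have Sub : ubound S b by move=> x [] /andP[].
have supS : has_sup S by split; [exists y0 | exists b].
have cb : sup S <= b by apply: ge_sup => //; exists y0.
have ac : a < sup S.
  exact: lt_le_trans ay0 (ub_le_sup supS.2 Sy0).
have Pac : P a (sup S).
  have [r r0 H] := Pl _ ac cb.
  have [x [/andP[ax xb] Pax] cx] := sup_adherent r0 supS.
  have xc := ub_le_sup supS.2 (conj (introT andP (conj ax xb)) Pax : S x).
  move: xc; rewrite le_eqVlt => /orP[/eqP <- //|xc].
  by apply: (Ptrans a x) => //; exact: H.
move: cb; rewrite le_eqVlt => /orP[/eqP <- //|cb].
have [y /andP[cy yb] Py] := Pr' _ (ltW ac) cb.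
have Sy : S y by split; [lra | apply: (Ptrans a (sup S)) => //; lra].
have := ub_le_sup supS.2 Sy; lra.
Qed.

Lemma seq_isolated (s : seq R) (x : R) : exists2 r, 0 < r &
  forall y, `|y - x| < r -> y \in s -> y = x.
Proof.
elim: s => [|z s [r r0 IH]]; first by exists 1.
have [->|zx] := eqVneq z x.
  exists r => // y yx; rewrite inE => /orP[/eqP // | ]; exact: IH.
have zx0 : 0 < `|z - x| by rewrite normr_gt0 subr_eq0.
exists (Num.min r `|z - x|); first by rewrite lt_min r0.
move=> y; rewrite lt_min inE => /andP[y1 y2] /orP[/eqP E|]; last exact: IH.
by move: y2; rewrite E ltxx.
Qed.

Variable g : R -> R * R.

Lemma det2_continuous (w : R * R) : continuous (det2 w).
Proof.
move=> x; rewrite /det2.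
apply: (@cvgB _ R^o); apply: cvgM; try exact: cvg_cst.
  exact: cvg_snd.
exact: cvg_fst.
Qed.

Lemma secant_side (w v : R * R) (k t : R) : is_derive t 1 g v ->
  0 < det2 w (k *: v) -> exists2 r, 0 < r &
    forall x, 0 < x -> x < r -> 0 < det2 w (g (t + k * x) - g t).
Proof.
move=> [gD gv]; rewrite det2Z -gv => H.
have C : (det2 w \o (fun h : R => h^-1 *: ((g \o shift t) (h *: 1) - g t)))
   h @[h --> 0^'] --> det2 w ('D_1 g t).
  apply: (@cvg_comp _ _ _ _ (det2 w)); first exact: gD.
  exact: det2_continuous.
have k0 : k != 0 by apply: contraTneq H => ->; rewrite mul0r ltxx.
have C' : (k * (det2 w \o
    (fun h : R => h^-1 *: ((g \o shift t) (h *: 1) - g t))) h) @[h --> 0^']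
    --> k * det2 w ('D_1 g t).
  by apply: cvgM => //; exact: cvg_cst.
have [e /= e0 He] := cvgr_gt _ C' _ H.
have ka : 0 < `|k| by rewrite normr_gt0.
exists (e / `|k|); first exact: divr_gt0.
move=> x x0 xr.
have kx0 : k * x != 0 by rewrite mulf_neq0 // gt_eqF.
have := He (k * x); rewrite /= /ball_ /= sub0r normrN normrM.
rewrite [X in X < e](_ : _ = x * `|k|); last first.
  by rewrite mulrC (gtr0_norm x0).
rewrite -ltr_pdivlMr // => K; have := K xr kx0.
have -> : (k * x)%:A = k * x :> R by rewrite /GRing.scale /= mulr1.
rewrite det2Z invfM mulrA mulrA divff // mul1r.
by rewrite pmulr_rgt0 ?invr_gt0 // (addrC (k * x)).
Qed.

(** The two factors [k] and [l] are directions, so that one statement covers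
    moving either point forwards, backwards or not at all. *)
Lemma side_open (w : R * R) (s t k l : R) : continuous g ->
  0 < det2 w (g s - g t) ->
  exists2 r, 0 < r & forall x y, 0 <= x -> x < r -> 0 <= y -> y < r ->
    0 < det2 w (g (s + k * x) - g (t + l * y)).
Proof.
move=> gC H.
have C (z m : R) : det2 w (g (z + m * h)) @[h --> (0 : R)] --> det2 w (g z).
  have E : z + m * h @[h --> (0 : R)] --> z.
    rewrite -[X in _ --> X]addr0 -[X in _ --> _ + X](mulr0 m).
    apply: cvgD; first exact: cvg_cst.
    by apply: cvgM; [exact: cvg_cst | exact: cvg_id].
  have E1 : g (z + m * h) @[h --> (0 : R)] --> g z.
    exact: (cvg_comp _ _ E (gC z)).
  exact: (cvg_comp _ _ E1 (@det2_continuous w (g z))).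
rewrite det2B subr_gt0 in H.
pose m := (det2 w (g s) + det2 w (g t)) / 2.
have H1 : m < det2 w (g s) by rewrite /m; lra.
have H2 : det2 w (g t) < m by rewrite /m; lra.
have [e1 /= e10 He1] := cvgr_gt _ (C s k) _ H1.
have [e2 /= e20 He2] := cvgr_lt _ (C t l) _ H2.
exists (Num.min e1 e2); first by rewrite lt_min e10.
move=> x y x0; rewrite !lt_min => /andP[x1 x2] y0 /andP[y1 y2].
rewrite det2B subr_gt0.
apply: (@lt_trans _ _ m); [apply: He2 | apply: He1].
  by rewrite /= sub0r normrN ger0_norm.
by rewrite /= sub0r normrN ger0_norm.
Qed.

Lemma derive1_periodic t : (forall u, g (u + 1) = g u) ->
  derive1 g (t + 1) = derive1 g t.
Proof.
move=> g1; rewrite /derive1; set a := (X in lim (X @ _)).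
suff -> : a = (fun h => h^-1 *: (g (h + t) - g t)) by [].
by apply/funext => h; rewrite /a addrA !g1.
Qed.

End RealAnalysis.

(** * Winding numbers of polygonal chains *)

Section Winding.
Variable R : realType.
Implicit Types (G : R -> R * R) (ts : seq R).

Fixpoint winding G (t : R) (ts : seq R) : int :=
  if ts is t' :: ts' then turn (G t) (G t') + winding G t' ts' else 0.

Lemma eq_winding G G' t ts : (forall u, u \in t :: ts -> G u = G' u) ->
  winding G t ts = winding G' t ts.
Proof.
elim: ts t => //= t' ts IH t H; rewrite !H ?inE ?eqxx ?orbT //.
by rewrite IH // => u Hu; apply: H; rewrite inE Hu orbT.
Qed.

(** Used when the local changes telescope along the chain; for a closed chain
    the total change is then zero. *)
Lemma winding_sub_potential G G' (e : rel R) (phi : R -> int) t ts :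
  (forall u v, e u v ->
     turn (G u) (G v) - turn (G' u) (G' v) = phi v - phi u) ->
  path e t ts -> winding G t ts - winding G' t ts = phi (last t ts) - phi t.
Proof.
move=> H; elim: ts t => [|t' ts IH] t /=; first by rewrite !subrr.
move=> /andP[/H tt' /IH]; lia.
Qed.

Lemma winding_sub_count G G' (e : rel R) (z : R) (a b : int) t ts :
  (forall u v, e u v -> turn (G u) (G v) - turn (G' u) (G' v)
     = a *+ (u == z) + b *+ (v == z)) ->
  path e t ts -> winding G t ts - winding G' t ts
     = a *+ count_mem z (belast t ts) + b *+ count_mem z ts.
Proof.
move=> H; elim: ts t => [|t' ts IH] t /=; first by rewrite !mulr0n subrr.
move=> /andP[/H E1 /IH E2].
by rewrite opprD addrACA E1 E2 !mulrnDr addrACA.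
Qed.

Lemma path_lt_bounds (t : R) ts u : path <%R t ts -> u \in t :: ts ->
  t <= u <= last t ts.
Proof.
elim: ts t u => [|t' ts IH] t u /=.
  by rewrite inE => _ /eqP ->; rewrite lexx.
move=> /andP[tt' P]; rewrite inE => /orP[/eqP ->|Hu].
  have /andP[_ E] := IH t' t' P (mem_head _ _).
  by rewrite lexx (le_trans (ltW tt')).
by have /andP[E ->] := IH t' u P Hu; rewrite (le_trans (ltW tt')).
Qed.

End Winding.

(** * Two closed arcs of a closed curve *)

Section TwoClosedArcs.
Variables (R : realType) (g d : R -> R * R) (p q : R).
Hypothesis g_d : forall t : R, is_derive t 1 g (d t).
Hypothesis g1 : forall t : R, g (t + 1) = g t.
Hypotheses (pq : p < q) (qp1 : q < p + 1).
Hypothesis gpq : g p = g q.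
Hypothesis d_neq0 : forall t, d t <> 0.
Hypothesis corner_transversal : det2 (d p) (d q) <> 0.
Hypothesis corner_simple_l : forall s, p < s -> s < q -> g s <> g q.
Hypothesis corner_simple_r : forall t, q < t -> t < p + 1 -> g t <> g q.
(* [Z] lists the common points of the two arcs other than the shared endpoint;
   the second parameter is in the universal cover of the circle. *)
Variable Z : seq (R * R).
Hypothesis Z_uniq : uniq Z.
Hypothesis Z_mem : forall s t, (s, t) \in Z <->
  [/\ p < s < q, q < t < p + 1 & g s = g t].
Hypothesis Z_fun : forall s t t', (s, t) \in Z -> (s, t') \in Z -> t = t'.
Hypothesis Z_transversal : forall s t, (s, t) \in Z -> det2 (d s) (d t) <> 0.

Lemma g_continuous : continuous g.
Proof.
move=> t; apply: differentiable_continuous; apply/derivable1_diffP.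
by have [] := g_d t.
Qed.

Lemma d_periodic t : d (t + 1) = d t.
Proof.
have E u : d u = derive1 g u by rewrite derive1E; have [_ ->] := g_d u.
by rewrite !E; exact: derive1_periodic.
Qed.

Lemma g_p1 : g (p + 1) = g q. Proof. by rewrite g1. Qed.

(** The direction [k] is a sign pointing from [s] into the segment from [a] to
    [b]. One-sided statements at interior points and at endpoints are thereby
    treated together. *)
Definition directs_into (a b k s : R) : Prop :=
  (k = 1 /\ s < b) \/ (k = -1 /\ a < s).

Lemma directs_into_neq0 a b k s : directs_into a b k s -> k != 0.
Proof. by move=> [[-> _]|[-> _]]; rewrite ?oppr_eq0 oner_eq0. Qed.

Lemma coincidence_cases s t : p <= s <= q -> q <= t <= p + 1 -> g s = g t ->
  (s, t) \in Z \/ ((s = p \/ s = q) /\ (t = q \/ t = p + 1)).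
Proof.
move=> /andP[ps sq] /andP[qt tp] E.
have Es : s = p \/ s = q -> g s = g q by case=> ->.
have Et : t = q \/ t = p + 1 -> g t = g q by case=> -> //; exact: g_p1.
have Cs : s = p \/ s = q \/ (p < s < q).
  move: ps sq; rewrite !le_eqVlt eq_sym => /orP[/eqP|->]; first by left.
  by case/orP => [/eqP|->]; auto.
have Ct : t = q \/ t = p + 1 \/ (q < t < p + 1).
  move: qt tp; rewrite !le_eqVlt eq_sym => /orP[/eqP|->]; first by left.
  by case/orP => [/eqP|->]; auto.
case: Cs => [Hs|[Hs|Hs]].
- right; split; first by left.
  case: Ct => [|[|/andP[t1 t2]]]; [by left | by right | ].
  by case: (corner_simple_r t1 t2); rewrite -E Hs.
- right; split; first by right.
  case: Ct => [|[|/andP[t1 t2]]]; [by left | by right | ].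
  by case: (corner_simple_r t1 t2); rewrite -E Hs.
- have /andP[s1 s2] := Hs.
  case: Ct => [Ht|[Ht|Ht]].
  + by case: (corner_simple_l s1 s2); rewrite E Ht.
  + by case: (corner_simple_l s1 s2); rewrite E Ht g_p1.
  + by left; apply/Z_mem.
Qed.

(** Near a common point (s, t), the differences [g s' - g t'], with [s'] on the
    side [k] of [s] and [t'] on the side [l] of [t], are
    sums of short secants close to the directions [k *: d s] and
    [- l *: d t]. They stay in one open half plane because these two vectors
    are not opposite: they are independent at a transversal double point, and
    equal when (s, t) is one of the two corners where the arcs follow each other
    smoothly. *)
Lemma quadrant_half_plane s t k l : p <= s <= q -> q <= t <= p + 1 ->
  g s = g t -> directs_into p q k s -> directs_into q (p + 1) l t ->
  exists w, 0 < det2 w (k *: d s) /\ 0 < det2 w (- l *: d t).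
Proof.
move=> Hs Ht E Dk Dl.
have indep : det2 (d s) (d t) <> 0 ->
    exists w, 0 < det2 w (k *: d s) /\ 0 < det2 w (- l *: d t).
  move=> H; apply: half_plane_independent.
  rewrite det2ZZ; apply/eqP; rewrite !mulf_neq0 ?(directs_into_neq0 Dk) //.
    by rewrite oppr_eq0 (directs_into_neq0 Dl).
  exact/eqP.
have same (v : R * R) : v <> 0 -> k *: d s = v -> - l *: d t = v ->
    exists w, 0 < det2 w (k *: d s) /\ 0 < det2 w (- l *: d t).
  by move=> v0 -> ->; have [w H] := half_plane_nonzero v0; exists w.
have ct := corner_transversal.
case: (coincidence_cases Hs Ht E) => [/Z_transversal /indep //|].
move=> [[]Es []Et].
- by apply: indep; rewrite Es Et.
- rewrite Es in Dk; rewrite Et in Dl.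
  case: Dk => [[Ek _]|[_]]; last by rewrite ltxx.
  case: Dl => [[_]|[El _]]; first by rewrite ltxx.
  apply: same (@d_neq0 p) _ _; first by rewrite Es Ek scale1r.
  by rewrite Et El opprK scale1r d_periodic.
- rewrite Es in Dk; rewrite Et in Dl.
  case: Dk => [[_]|[Ek _]]; first by rewrite ltxx.
  case: Dl => [[El _]|[_]]; last by rewrite ltxx.
  have dq0 : - d q <> 0 by apply/eqP; rewrite oppr_eq0; apply/eqP.
  by apply: same dq0 _ _; rewrite ?Es ?Et ?Ek ?El ?scaleN1r.
- apply: indep; rewrite Es Et d_periodic det2C => /eqP.
  by rewrite oppr_eq0 => /eqP.
Qed.

(** The chord from [g t0] to [g t1] is seen from [g s] under an angle less than
    half a turn; [l] is the sign of [t1 - t0]. If [g s] is the end [g t0] of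
    the chord, the viewpoint is replaced by an infinitesimal move along the
    first arc, and the tangent [- l *: d t0] is required in the same half plane,
    so that the chord lies on the same side of the first arc as the second arc does. *)
Definition visible_from (l t0 t1 s : R) : Prop :=
  [/\ g s <> g t1,
      g s <> g t0 -> exists w,
        0 < det2 w (g s - g t0) /\ 0 < det2 w (g s - g t1)
    & g s = g t0 -> forall k, directs_into p q k s -> exists w,
        [/\ 0 < det2 w (k *: d s), 0 < det2 w (g s - g t1)
          & 0 < det2 w (- l *: d t0)]].

Lemma det2_sub_gt0_neq w (s t : R) : 0 < det2 w (g s - g t) -> g s <> g t.
Proof. by move=> /det2_gt0_neq0 H E; apply: H; rewrite E subrr. Qed.

(** The statement keeps the admissibility of [k] after the radius, in order to
    take the minimum over both signs later. *)
Lemma visible_base s0 t0 l k : p <= s0 <= q -> q <= t0 <= p + 1 ->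
  g s0 = g t0 -> directs_into q (p + 1) l t0 -> exists2 r, 0 < r &
    directs_into p q k s0 -> forall x, 0 < x -> x < r -> exists w,
      [/\ 0 < det2 w (k *: d s0), 0 < det2 w (g s0 - g (t0 + l * x))
        & 0 < det2 w (- l *: d t0)].
Proof.
move=> Hs Ht E Dl.
have [Dk|nDk] := pselect (directs_into p q k s0); last by exists 1.
have [w [w1 w2]] := quadrant_half_plane Hs Ht E Dk Dl.
have [r r0 Hr] : exists2 r, 0 < r & forall x, 0 < x -> x < r ->
    0 < det2 (- w) (g (t0 + l * x) - g t0).
  by apply: (secant_side (g_d _)); move: w2; rewrite det2Nl !det2Z mulNr.
exists r => // _ x x0 xr; exists w; split => //.
by have := Hr x x0 xr; rewrite det2Nl E !det2B; lra.
Qed.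

Lemma visible_local s0 t0 k l : p <= s0 <= q -> q <= t0 <= p + 1 ->
  directs_into p q k s0 -> directs_into q (p + 1) l t0 ->
  exists2 r, 0 < r & forall y x, 0 <= y -> y < r -> 0 < x -> x < r ->
    visible_from l t0 (t0 + l * x) (s0 + k * y).
Proof.
move=> Hs Ht Dk Dl; have [E|nE] := pselect (g s0 = g t0); last first.
  have [w H] : exists w, 0 < det2 w (g s0 - g t0).
    by apply: half_plane_nonzero => /eqP; rewrite subr_eq0 => /eqP.
  have [r r0 Hr] := side_open k l g_continuous H.
  exists r => // y x y0 yr x0 xr.
  have H1 := Hr y x y0 yr (ltW x0) xr.
  have := Hr y 0 y0 yr (lexx 0) r0; rewrite mulr0 addr0 => H2.
  split; first exact: det2_sub_gt0_neq H1.
    by exists w.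
  by move: (det2_sub_gt0_neq H2).
have [w [w1 w2]] := quadrant_half_plane Hs Ht E Dk Dl.
have [r1 r10 Hr1] := secant_side (g_d _) w1.
have [r2 r20 Hr2] : exists2 r, 0 < r & forall x, 0 < x -> x < r ->
    0 < det2 w (g t0 - g (t0 + l * x)).
  have w2' : 0 < det2 (- w) (l *: d t0).
    by move: w2; rewrite det2Nl !det2Z mulNr.
  have [r r0 Hr] := secant_side (g_d _) w2'.
  exists r => // x x0 xr; have := Hr x x0 xr.
  by rewrite det2Nl !det2B; lra.
have [r3 r30 Hr3] := visible_base 1 Hs Ht E Dl.
have [r4 r40 Hr4] := visible_base (-1) Hs Ht E Dl.
exists (Num.min (Num.min r1 r2) (Num.min r3 r4)).
  by rewrite !lt_min r10 r20 r30.
move=> y x y0; rewrite !lt_min => /andP[/andP[y1 _] _] x0.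
move=> /andP[/andP[_ x2] /andP[x3 x4]].
have T := Hr2 x x0 x2.
move: y0; rewrite le_eqVlt => /orP[/eqP <-|y0].
  rewrite mulr0 addr0; split.
  - by apply: (@det2_sub_gt0_neq w); rewrite E.
  - by [].
  - move=> _ k' Dk'; have [[Ek _]|[Ek _]] := Dk'; move: Dk'; rewrite Ek => Dk'.
      exact: Hr3.
    exact: Hr4.
have S := Hr1 y y0 y1; rewrite E in S.
have ST : 0 < det2 w (g (s0 + k * y) - g (t0 + l * x)).
  rewrite (_ : _ - _ = (g (s0 + k * y) - g t0) + (g t0 - g (t0 + l * x))).
    by rewrite det2D addr_gt0.
  by rewrite addrA subrK.
split; first exact: det2_sub_gt0_neq ST.
  by exists w.
by move: (det2_sub_gt0_neq S).
Qed.

(** The radius is made uniform in [s] by interval induction along the first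
    arc. *)
Lemma visible_strip t0 l : q <= t0 <= p + 1 -> directs_into q (p + 1) l t0 ->
  exists2 r, 0 < r & forall s x, p <= s -> s <= q -> 0 < x -> x < r ->
    visible_from l t0 (t0 + l * x) s.
Proof.
move=> Ht Dl.
suff [r r0 H] : exists2 r, 0 < r & forall s, p <= s <= q -> forall x,
    0 < x -> x < r -> visible_from l t0 (t0 + l * x) s.
  by exists r => // s x s1 s2; apply: H; rewrite s1.
apply: (interval_induction (P := fun u v => exists2 r, 0 < r & forall s,
    u <= s <= v -> forall x, 0 < x -> x < r ->
    visible_from l t0 (t0 + l * x) s)) => //.
- move=> u v w _ _ _ _ [r1 r10 H1] [r2 r20 H2].
  exists (Num.min r1 r2); first by rewrite lt_min r10.
  move=> s /andP[us sw] x x0; rewrite lt_min => /andP[x1 x2].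
  have [sv|vs] := leP s v; first by apply: H1 => //; rewrite us.
  by apply: H2 => //; rewrite sw ltW.
- move=> s0 ps sq; have Hs : p <= s0 <= q by rewrite ps ltW.
  have [|r r0 H] := visible_local (k := 1) Hs Ht _ Dl; first by left.
  exists r => // y sy yr _; exists r => // s /andP[ss sy'] x x0 xr.
  have -> : s = s0 + 1 * (s - s0) by ring.
  by apply: H => //; lra.
- move=> s0 ps sq; have Hs : p <= s0 <= q by rewrite sq ltW.
  have [|r r0 H] := visible_local (k := -1) Hs Ht _ Dl; first by right.
  exists r => // y sy yr _; exists r => // s /andP[ss sy'] x x0 xr.
  have -> : s = s0 + -1 * (s0 - s) by ring.
  by apply: H => //; lra.
Qed.

(** The last condition forces every common point of the arcs to be a vertex of
    the polygon. *)
Definition chord (t t' : R) : Prop :=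
  [/\ q <= t /\ t' <= p + 1, t < t',
      (forall s, p <= s -> s <= q -> visible_from 1 t t' s) \/
      (forall s, p <= s -> s <= q -> visible_from (-1) t' t s)
    & forall s x, p <= s -> s <= q -> t < x -> x < t' -> g s <> g x].

Definition chordb : rel R := fun t t' => `[< chord t t' >].

Lemma inscribed_polygon : exists ts, path chordb q ts /\ last q ts = p + 1.
Proof.
apply: (interval_induction
  (P := fun u v => exists ts, path chordb u ts /\ last u ts = v)) => //.
- move=> u v w _ _ _ _ [ts1 [P1 <-]] [ts2 [P2 <-]].
  by exists (ts1 ++ ts2); rewrite cat_path last_cat P1.
- move=> t qt tp.
  have [||r r0 H] := @visible_strip t 1; first by rewrite qt (ltW tp).
    by left.
  exists r => // t' tt' tr tp'; exists [:: t']; split => //=.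
  rewrite andbT; apply/asboolP; split => //; first by split => //; lra.
    left => s ps sq; have -> : t' = t + 1 * (t' - t) by ring.
    by apply: H => //; lra.
  move=> s x ps sq tx xt'; have -> : x = t + 1 * (x - t) by ring.
  by have [||//] := H s (x - t) ps sq; lra.
- move=> t qt tp.
  have [||r r0 H] := @visible_strip t (-1); first by rewrite tp (ltW qt).
    by right.
  exists r => // t' tt' tr tp'; exists [:: t]; split => //=.
  rewrite andbT; apply/asboolP; split => //; first by split => //; lra.
    right => s ps sq; have -> : t' = t + -1 * (t - t') by ring.
    by apply: H => //; lra.
  move=> s x ps sq tx xt'; have -> : x = t + -1 * (t - x) by ring.
  by have [||//] := H s (t - x) ps sq; lra.
Qed.

(** The position of [g s] seen from [g t], where a zero is replaced by the
    direction [k *: d s] in which [g s] is about to move away. *)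
Definition blowup (k s t : R) : R * R :=
  if g s == g t then k *: d s else g s - g t.

Lemma blowup_eq k s t : g s = g t -> blowup k s t = k *: d s.
Proof. by rewrite /blowup => ->; rewrite eqxx. Qed.

Lemma blowup_neq k s t : g s <> g t -> blowup k s t = g s - g t.
Proof. by move=> /eqP H; rewrite /blowup (negbTE H). Qed.

Lemma blowup_congr k s t t' : g t = g t' -> blowup k s t = blowup k s t'.
Proof. by rewrite /blowup => ->. Qed.

Lemma visible_half_plane l t0 t1 k s : visible_from l t0 t1 s ->
  directs_into p q k s ->
  exists w, 0 < det2 w (blowup k s t0) /\ 0 < det2 w (blowup k s t1).
Proof.
move=> [n1 H1 H2] Dk; rewrite (blowup_neq _ n1).
have [E|n0] := pselect (g s = g t0).
  by have [w [w1 w2 _]] := H2 E k Dk; exists w; rewrite blowup_eq.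
by have [w [w1 w2]] := H1 n0; exists w; rewrite blowup_neq.
Qed.

Lemma chord_half_plane t t' k s : chord t t' -> p <= s <= q ->
  directs_into p q k s ->
  exists w, 0 < det2 w (blowup k s t) /\ 0 < det2 w (blowup k s t').
Proof.
move=> [_ _ C _] /andP[ps sq] Dk; case: C => /(_ s ps sq) V.
  exact: visible_half_plane V Dk.
by have [w []] := visible_half_plane V Dk; exists w.
Qed.

Lemma blowup_limit w k s t : 0 < det2 w (blowup k s t) -> exists2 r, 0 < r &
  forall x, 0 < x -> x < r -> 0 < det2 w (g (s + k * x) - g t).
Proof.
have [E|n0] := pselect (g s = g t).
  by rewrite blowup_eq // -E; exact: (secant_side (g_d _)).
rewrite blowup_neq // => H; have [r r0 Hr] := side_open k 0 g_continuous H.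
exists r => // x x0 xr; have := Hr x 0 (ltW x0) xr (lexx 0) r0.
by rewrite mulr0 addr0.
Qed.

(** Each edge and its perturbation lie in one half plane, so the change of its
    turn is the difference of a potential at its two ends. *)
Lemma winding_blowup_limit k s t ts : p <= s <= q -> directs_into p q k s ->
  path chordb t ts -> exists2 r, 0 < r & forall x, 0 < x -> x < r ->
  winding (fun u => g (s + k * x) - g u) t ts =
    winding (blowup k s) t ts
    + turn (blowup k s (last t ts)) (g (s + k * x) - g (last t ts))
    - turn (blowup k s t) (g (s + k * x) - g t).
Proof.
move=> Hs Dk; elim: ts t => [|t' ts IH] t /=.
  by exists 1 => // x _ _; rewrite add0r subrr.
move=> /andP[/asboolP C /IH [r r0 Hr]].
have [w [w1 w2]] := chord_half_plane C Hs Dk.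
have [r1 r10 Hr1] := blowup_limit w1.
have [r2 r20 Hr2] := blowup_limit w2.
exists (Num.min r (Num.min r1 r2)); first by rewrite !lt_min r0 r10.
move=> x x0; rewrite !lt_min => /and3P[xr x1 x2].
rewrite (Hr x x0 xr).
have y1 := Hr1 x x0 x1; have y2 := Hr2 x x0 x2.
rewrite (turn_chain y1 w1 y2) (turn_chain w1 w2 y2) (turnC (blowup k s t)).
by ring.
Qed.

Section Polygon.
Variable ts : seq R.
Hypothesis ts_path : path chordb q ts.
Hypothesis ts_last : last q ts = p + 1.

(** The winding number of the polygon about the points [g (s + k * x)] for small
    positive [x]. *)
Definition side_winding (k s : R) : int := winding (blowup k s) q ts.

(** The boundary terms of [winding_blowup_limit] cancel because the polygon
    closes up. *)
Lemma side_winding_limit k s : p <= s <= q -> directs_into p q k s ->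
  exists2 r, 0 < r & forall x, 0 < x -> x < r ->
    winding (fun u => g (s + k * x) - g u) q ts = side_winding k s.
Proof.
move=> Hs Dk; have [r r0 Hr] := winding_blowup_limit Hs Dk ts_path.
exists r => // x x0 xr; rewrite (Hr x x0 xr) ts_last.
by rewrite (blowup_congr k s g_p1) g_p1 addrK.
Qed.

Lemma polygon_lt : path <%R q ts.
Proof. by apply: sub_path ts_path => t t' /asboolP[]. Qed.

Lemma polygon_bounds t : t \in q :: ts -> q <= t <= p + 1.
Proof. by move=> /(path_lt_bounds polygon_lt); rewrite ts_last. Qed.

Lemma side_winding_regular k s : p < s -> s < q ->
  (forall z, z \in Z -> z.1 <> s) ->
  side_winding k s = winding (fun u => g s - g u) q ts.
Proof.
move=> ps sq H; apply: eq_winding => t /polygon_bounds Ht.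
apply: blowup_neq => E.
have [|/H //|[[]Es _]] := coincidence_cases _ Ht E.
- by rewrite !ltW.
- by move: ps; rewrite Es ltxx.
- by move: sq; rewrite Es ltxx.
Qed.

(** Leaving [g p] in the direction [d p] or [g q] in the direction [- d q] gives
    the same difference vectors except at the two ends of the polygon. There
    the replacement of [d p] by [- d q] changes the turns of the first and of
    the last edge by opposite amounts, since both directions and the edge lie
    in one half plane. *)
Lemma side_winding_corner : side_winding 1 p = side_winding (-1) q.
Proof.
have Hp : p <= p <= q by rewrite lexx ltW.
have Hq : p <= q <= q by rewrite lexx ltW.
have Dp : directs_into p q 1 p by left.
have Dq : directs_into p q (-1) q by right.
pose a := turn (d p) (- d q).
apply/eqP; rewrite -subr_eq0; apply/eqP.
rewrite (winding_sub_potential (phi := fun t => - a *+ (g q == g t)) _ ts_path).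
  by rewrite ts_last g_p1 subrr.
move=> t t' /asboolP[[qt tp] tt' V _].
have nE u : g p <> g u -> blowup 1 p u = blowup (-1) q u.
  by move=> H; rewrite !blowup_neq -?gpq.
have yE u : g p = g u -> blowup 1 p u = d p /\ blowup (-1) q u = - d q.
  by move=> H; rewrite !blowup_eq -?gpq // scale1r scaleN1r.
rewrite -gpq.
case: V => V.
- have [n1 _ H] := V p (lexx p) (ltW pq).
  rewrite (negbTE (introN eqP n1)) -(nE _ n1) (blowup_neq _ n1).
  have [E|n0] := pselect (g p = g t); last first.
    by rewrite (negbTE (introN eqP n0)) (nE _ n0) !subrr.
  have [w [w1 w2 w3]] := H E _ Dp; have [-> ->] := yE _ E.
  have Et : t = q.
    have Ht : q <= t <= p + 1 by rewrite qt (ltW (lt_le_trans tt' tp)).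
    have [/Z_mem[] | [_ [//|Et]]] := coincidence_cases Hp Ht E.
      by rewrite ltxx.
    by move: tt'; rewrite Et ltNge tp.
  rewrite Et scaleN1r in w3; rewrite scale1r in w1.
  rewrite (turn_chain w1 w3 w2) E eqxx /= mulr0n mulr1n /a; ring.
- have [n1 _ H] := V q (ltW pq) (lexx q); rewrite -gpq in n1 H.
  rewrite (negbTE (introN eqP n1)) -(nE _ n1) (blowup_neq _ n1).
  have [E|n0] := pselect (g p = g t'); last first.
    by rewrite (negbTE (introN eqP n0)) (nE _ n0) !subrr.
  have [w [w1 w2 w3]] := H E _ Dq; have [-> ->] := yE _ E.
  have Et : t' = p + 1.
    have Ht : q <= t' <= p + 1 by rewrite tp (ltW (le_lt_trans qt tt')).
    have [/Z_mem[] | [_ [Et|//]]] := coincidence_cases Hp Ht E.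
      by rewrite ltxx.
    by move: tt'; rewrite Et ltNge qt.
  rewrite Et d_periodic opprK scale1r in w3; rewrite scaleN1r in w1.
  rewrite (turn_chain w2 w3 w1) E eqxx /= mulr0n mulr1n /a; ring.
Qed.

Lemma polygon_vertex s t : (s, t) \in Z -> t \in ts.
Proof.
move=> /Z_mem[/andP[ps sq] /andP[qt tp] E].
suff H u : path chordb u ts -> u < t -> t < last u ts -> t \in ts.
  by apply: (H q) => //; rewrite ts_last.
elim: ts u => [|t' ts' IH] u /=.
  by move=> _ ut tu; have := lt_trans ut tu; rewrite ltxx.
move=> /andP[/asboolP[_ _ _ N] P] ut tl; rewrite inE.
case: (ltgtP t t') => [tt'|t't|//] /=; last exact: IH P t't tl.
by case: (N s t) => //; apply: ltW.
Qed.

(** Only the two edges at the vertex [t] see the difference between [d s] and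
    [- d s]. In each of them the other vertex can be replaced by the tangent
    [- d t] or [d t], which leaves the four turns of [turn_full]. *)
Lemma side_winding_jump s t : (s, t) \in Z ->
  side_winding 1 s - side_winding (-1) s
    = - frame_sign (d s) (d t).
Proof.
move=> Hst; have /Z_mem[/andP[ps sq] /andP[qt tp] E] := Hst.
have Zt u : q <= u <= p + 1 -> g s = g u -> u = t.
  move=> Hu Eu; have Hs : p <= s <= q by rewrite !ltW.
  have [/Z_fun/(_ Hst) //|[[]Es _]] := coincidence_cases Hs Hu Eu.
  - by move: ps; rewrite Es ltxx.
  - by move: sq; rewrite Es ltxx.
have D1 : directs_into p q 1 s by left.
have D2 : directs_into p q (-1) s by right.
have U : uniq (q :: ts).
  by apply: (sorted_uniq lt_trans ltxx); exact: polygon_lt.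
have tq : t != q by apply: contraTneq qt => ->; rewrite ltxx.
have tpn : t != p + 1 by apply: contraTneq tp => ->; rewrite ltxx.
have mt := polygon_vertex Hst.
rewrite (winding_sub_count (z := t)
  (a := turn (d s) (- d t) - turn (- d s) (- d t))
  (b := turn (d t) (d s) - turn (d t) (- d s)) _ ts_path).
  have C2 : count_mem t ts = 1%N.
    by move: U => /= /andP[_ U]; rewrite count_uniq_mem // mt.
  have C1 : count_mem t (belast q ts) = 1%N.
    have := congr1 (count_mem t) (lastI q ts).
    rewrite -cats1 count_cat /= C2 ts_last.
    by rewrite eq_sym (negbTE tq) eq_sym (negbTE tpn) !addn0 add0n.
  by rewrite C1 C2 !mulr1n turn_full //; exact: Z_transversal.
move=> u v /asboolP[[qu vp] uv V _].
have Hu : q <= u <= p + 1 by rewrite qu (ltW (lt_le_trans uv vp)).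
have Hv : q <= v <= p + 1 by rewrite vp (ltW (le_lt_trans qu uv)).
have nE x : g s <> g x ->
    [/\ blowup 1 s x = g s - g x, blowup (-1) s x = g s - g x
      & (x == t) = false].
  move=> H; rewrite !blowup_neq //; split => //.
  by apply/eqP => Ex; apply: H; rewrite E Ex.
have yE x : g s = g x -> blowup 1 s x = d s /\ blowup (-1) s x = - d s.
  by move=> H; rewrite !blowup_eq // scale1r scaleN1r.
case: V => /(_ s (ltW ps) (ltW sq)) [n1 _ H]; have [-> -> ->] := nE _ n1.
- have [Eu|n0] := pselect (g s = g u); last first.
    by have [-> -> ->] := nE _ n0; rewrite !mulr0n subrr.
  have [w1 [a1 b1 c1]] := H Eu _ D1; have [w2 [a2 b2 c2]] := H Eu _ D2.
  have [-> ->] := yE _ Eu; have Et := Zt _ Hu Eu.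
  rewrite Et scale1r scaleN1r in a1 c1; rewrite Et !scaleN1r in a2 c2.
  rewrite (turn_chain a1 c1 b1) (turn_chain a2 c2 b2) Et eqxx mulr0n mulr1n.
  by ring.
- have [Eu|n0] := pselect (g s = g v); last first.
    by have [-> -> ->] := nE _ n0; rewrite !mulr0n subrr.
  have [w1 [a1 b1 c1]] := H Eu _ D1; have [w2 [a2 b2 c2]] := H Eu _ D2.
  have [-> ->] := yE _ Eu; have Et := Zt _ Hv Eu.
  rewrite Et opprK !scale1r in a1 c1.
  rewrite Et opprK scale1r scaleN1r in a2 c2.
  rewrite (turn_chain b1 c1 a1) (turn_chain b2 c2 a2) Et eqxx mulr0n mulr1n.
  by ring.
Qed.

(** The one-sided windings are what makes the formula additive: at a
    subdivision point the missing term is exactly the jump there. *)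
Lemma side_winding_sum : side_winding (-1) q - side_winding 1 p =
  \sum_(z <- Z | p < z.1 < q) - frame_sign (d z.1) (d z.2).
Proof.
pose J (z : R * R) : int := - frame_sign (d z.1) (d z.2).
have near_side k s : p <= s <= q -> directs_into p q k s ->
    exists2 r, 0 < r & forall x, 0 < x -> x < r -> p < s + k * x < q ->
      (forall z, z \in Z -> `|z.1 - s| < r -> z.1 = s) /\
      forall k', side_winding k' (s + k * x) = side_winding k s.
  move=> Hs Dk; have [r1 r10 H1] := side_winding_limit Hs Dk.
  have [r2 r20 H2] := seq_isolated (map fst Z) s.
  exists (Num.min r1 r2); first by rewrite lt_min r10.
  move=> x x0; rewrite lt_min => /andP[x1 x2] /andP[px xq].
  have I z : z \in Z -> `|z.1 - s| < r2 -> z.1 = s.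
    by move=> zZ zr; apply: H2 => //; exact: map_f.
  split; first by move=> z zZ; rewrite lt_min => /andP[_]; exact: I.
  move=> k'; rewrite (side_winding_regular _ px xq) ?H1 // => z zZ zs.
  have D : `|s + k * x - s| = x.
    rewrite addrC addKr; case: Dk => [[-> _]|[-> _]].
      by rewrite mul1r gtr0_norm.
    by rewrite mulN1r normrN gtr0_norm.
  have := I z zZ; rewrite zs D => /(_ x2) Es.
  by move: D; rewrite Es subrr normr0 => Ex; move: x0; rewrite -Ex ltxx.
apply: (interval_induction (P := fun u v => side_winding (-1) v
    - side_winding 1 u = \sum_(z <- Z | u < z.1 < v) J z)) => //.
- move=> u v w pu uv vw wq E1 E2.
  have -> : side_winding (-1) w - side_winding 1 u =
    (side_winding (-1) v - side_winding 1 u)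
    + (side_winding 1 v - side_winding (-1) v)
    + (side_winding (-1) w - side_winding 1 v) by ring.
  rewrite E1 E2 {E1 E2}.
  have -> : side_winding 1 v - side_winding (-1) v
          = \sum_(z <- Z | z.1 == v) J z.
    have [[z zZ zv]|N] := pselect (exists2 z, z \in Z & z.1 = v).
      case: z zZ zv => s t /= zZ <-; rewrite (side_winding_jump zZ).
      rewrite big_mkcond (bigD1_seq (s, t)) //= eqxx.
      rewrite big_seq_cond big1 ?addr0 //.
      move=> [s' t'] /andP[z'Z /eqP E2] /=; case: eqP => // E1; case: E2.
      by rewrite E1 in z'Z *; rewrite (Z_fun zZ z'Z).
    rewrite big_seq_cond big1 => [|z /andP[zZ /eqP zv]]; last first.
      by case: N; exists z.
    rewrite !side_winding_regular ?subrr //.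
    - exact: le_lt_trans pu uv.
    - exact: lt_le_trans vw wq.
    - by move=> z zZ zv; apply: N; exists z.
    - exact: le_lt_trans pu uv.
    - exact: lt_le_trans vw wq.
    - by move=> z zZ zv; apply: N; exists z.
  rewrite big_mkcond [X in _ + X + _]big_mkcond [X in _ + X]big_mkcond.
  rewrite [RHS]big_mkcond -!big_split; apply: eq_bigr => z _ /=.
  case: (ltgtP z.1 v) => [zv|vz|->].
  - by rewrite (lt_trans zv vw) !andbT !addr0.
  - by rewrite (lt_trans uv vz) andbF /= !add0r.
  - by rewrite uv vw andbF /= addr0 add0r.
- move=> s ps sq; have Hs : p <= s <= q by rewrite ps ltW.
  have [|r r0 H] := near_side 1 s Hs; first by left.
  exists r => // v sv vr vq.
  have [|||I E] := H (v - s); try lra.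
  have := E (-1); rewrite mul1r addrC subrK => ->.
  rewrite subrr big_seq_cond big1 // => z /andP[zZ /andP[z1 z2]].
  have := I z zZ; rewrite gtr0_norm ?subr_gt0 // => zs.
  have zr : z.1 - s < r by lra.
  by move: z1; rewrite (zs zr) ltxx.
- move=> s ps sq; have Hs : p <= s <= q by rewrite sq ltW.
  have [|r r0 H] := near_side (-1) s Hs; first by right.
  exists r => // v sv vr vq.
  have [|||I E] := H (s - v); try lra.
  have := E 1; rewrite mulN1r opprB addrC subrK => ->.
  rewrite subrr big_seq_cond big1 // => z /andP[zZ /andP[z1 z2]].
  have := I z zZ; rewrite ltr0_norm ?subr_lt0 // => zs.
  have zr : - (z.1 - s) < r by lra.
  by move: z2; rewrite (zs zr) ltxx.
Qed.

End Polygon.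

(** The algebraic intersection number of the two closed arcs vanishes. *)
Theorem closed_arcs_intersection_sum :
  \sum_(z <- Z) frame_sign (d z.1) (d z.2) = 0.
Proof.
have [ts [P L]] := inscribed_polygon.
have := side_winding_sum P L; rewrite (side_winding_corner P L) subrr sumrN.
move=> /esym/eqP; rewrite oppr_eq0 => /eqP E.
rewrite -[RHS]E [LHS]big_seq_cond [RHS]big_seq_cond.
apply: eq_bigl => -[s t] /=; rewrite andbT.
by case H : (_ \in Z) => //=; have [-> _ _] := iffLR (Z_mem _ _) H.
Qed.

End TwoClosedArcs.

(** * The halves of a virtual knot diagram *)

Section Diagram.
Variables (R : realType) (D : virtual_knot_diagram R).
Local Notation g := (curve D).

Definition passage_seq : seq (R * R) :=
  finmap.enum_fset (fset_set (passages D)).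
Local Notation S := passage_seq.

Lemma passage_seqP (z : R * R) : reflect (passages D z) (z \in S).
Proof.
rewrite /passage_seq; apply: (iffP idP).
  by rewrite (in_fset_set (@curve_finite _ D)) => /set_mem.
by move=> H; rewrite (in_fset_set (@curve_finite _ D)); exact: mem_set.
Qed.

Lemma passage_seq_uniq : uniq S.
Proof. exact: finmap.fset_uniq. Qed.

Definition passage_sign (z : R * R) : int :=
  frame_sign (dir D z.1) (dir D z.2).

Definition swap (z : R * R) : R * R := (z.2, z.1).

Lemma swap_passages z : passages D z -> passages D (swap z).
Proof.
by case: z => s t [/= H1 H2 H3 H4]; split => //= E; apply: H3.
Qed.

Lemma passages_transversal z : passages D z ->
  det2 (dir D z.1) (dir D z.2) != 0.
Proof. by case: z => s t H; apply/eqP; exact: curve_transversal. Qed.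

Lemma passage_sign_swap z : passages D z ->
  passage_sign (swap z) = - passage_sign z.
Proof.
by move=> /passages_transversal; exact: frame_signC.
Qed.

(** Each double point gives two passages, exchanged by [swap], with opposite
    signs. *)
Lemma sum_swap (Q : pred (R * R)) :
  \sum_(z <- S | Q z) passage_sign z
    = - \sum_(z <- S | Q (swap z)) passage_sign z.
Proof.
have P : perm_eq S (map swap S).
  apply: uniq_perm; first exact: passage_seq_uniq.
    rewrite map_inj_uniq ?passage_seq_uniq //.
    by move=> [s t] [s' t'] [-> ->].
  move=> z; apply/idP/mapP => [/passage_seqP H|[z' /passage_seqP H ->]].
    exists (swap z); last by case: z {H}.
    by apply/passage_seqP/swap_passages.
  by apply/passage_seqP/swap_passages.
rewrite (perm_big _ P) big_map /= -sumrN [LHS]big_seq_cond [RHS]big_seq_cond.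
apply: eq_bigr => z /andP[/passage_seqP H _]; exact: passage_sign_swap.
Qed.

Lemma double_point_preimages u v s : passages D (u, v) -> circle_pt s ->
  g s = g u -> s = u \/ s = v.
Proof.
move=> [/= Hu Hv uv E] Hs Es.
by case: (curve_no_triple Hs Hu Hv Es E) => [|/uv|]; auto.
Qed.

Section InnerArc.
Variables p q : R.
Hypotheses (Hpq : passages D (p, q)) (pq : p < q).

Definition leaves_inner_arc (z : R * R) : bool :=
  (p < z.1 < q) && ((z.2 < p) || (q < z.2)).

(** The complement of the inner arc passes through the base point of the circle;
    adding a period to its initial part turns it into the segment from [q] to
    [p + 1]. *)
Definition unroll (z : R * R) : R * R :=
  (z.1, if z.2 < p then z.2 + 1 else z.2).

Definition unrolled_passages : seq (R * R) :=
  map unroll [seq z <- S | leaves_inner_arc z].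

Lemma unrolled_passagesP s t : reflect
  (exists2 t', passages D (s, t') & leaves_inner_arc (s, t') /\
     t = if t' < p then t' + 1 else t')
  ((s, t) \in unrolled_passages).
Proof.
apply: (iffP mapP) => [[[s' t']]|[t' H [L ->]]].
  by rewrite mem_filter => /andP[L /passage_seqP H] [-> ->]; exists t'.
by exists (s, t') => //; rewrite mem_filter L; apply/passage_seqP.
Qed.

Lemma mem_unrolled_passages s t : (s, t) \in unrolled_passages <->
  [/\ p < s < q, q < t < p + 1 & g s = g t].
Proof.
have [/= /andP[p0 p1] /andP[q0 q1] _ _] := Hpq.
split=> [/unrolled_passagesP[t' [/= _ /andP[t0 t1] _ E] [/andP[Hs Ht] ->]]|].
  move: Ht => /=; case: ltP => [tp _|pt /= qt].
    by split => //; [lra | rewrite curve_periodic].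
  by split => //; lra.
move=> [/andP[ps sq] /andP[qt tp] E]; apply/unrolled_passagesP.
have Hs : circle_pt s by apply/andP; split; lra.
have [t1|t1] := ltP t 1.
  have Ht : circle_pt t by apply/andP; split; lra.
  exists t; first by split => //= st; move: qt; rewrite -st; lra.
  rewrite /leaves_inner_arc /= ps sq qt orbT; split => //.
  by case: ltP => //; lra.
have Ht : circle_pt (t - 1) by apply/andP; split; lra.
exists (t - 1).
  split => //=; first by move=> st; lra.
  by rewrite E -(curve_periodic D (t - 1)) subrK.
have tp' : t - 1 < p by lra.
by rewrite /leaves_inner_arc /= ps sq tp' subrK.
Qed.

Lemma unroll_inj : {in [seq z <- S | leaves_inner_arc z] &, injective unroll}.
Proof.
move=> [s t] [s' t']; rewrite !mem_filter => /andP[_ /passage_seqP H].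
move=> /andP[_ /passage_seqP H'] [-> /= E].
have [_ /= /andP[t0 t1] _ _] := H; have [_ /= /andP[t0' t1'] _ _] := H'.
congr (_, _); move: E; case: ltP => ?; case: ltP => ? E; lra.
Qed.

Lemma inner_arc_sum :
  \sum_(z <- S | leaves_inner_arc z) passage_sign z = 0.
Proof.
have [/= Hp Hq _ E] := Hpq.
have /andP[p0 p1] := Hp; have /andP[q0 q1] := Hq.
have gd (t : R) : is_derive t 1 g (dir D t).
  rewrite /dir derive1E; apply: DeriveDef => //; exact: curve_derivable.
have d1 (t : R) : dir D (t + 1) = dir D t.
  by apply: derive1_periodic; exact: curve_periodic.
have notq s : circle_pt s -> s <> p -> s <> q -> g s <> g q.
  move=> Hs sp sq Es; rewrite -E in Es.
  by case: (double_point_preimages Hpq Hs Es).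
clear E; rewrite -big_filter.
have -> : \sum_(z <- [seq z <- S | leaves_inner_arc z]) passage_sign z
        = \sum_(z <- unrolled_passages) passage_sign z.
  rewrite big_map; apply: eq_bigr => z _; rewrite /passage_sign /=.
  by case: ifP => _; rewrite ?d1.
apply: (@closed_arcs_intersection_sum R g (dir D) p q) => //.
- exact: curve_periodic.
- lra.
- by have [_ _ _ E] := Hpq.
- exact: curve_immersion.
- by have /eqP := passages_transversal Hpq.
- by move=> s ps sq; apply: notq; [apply/andP; split; lra | lra | lra].
- move=> t qt tp; have pt := lt_trans pq qt; have [t1|t1] := ltP t 1.
    by apply: notq; [apply/andP; split; lra | move=> ?; lra | move=> ?; lra].
  have tp' : t - 1 < p by lra.
  have tq' := lt_trans tp' pq.
  rewrite -(subrK 1 t) curve_periodic.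
  by apply: notq; [apply/andP; split; lra | move=> ?; lra | move=> ?; lra].
- rewrite map_inj_in_uniq ?filter_uniq ?passage_seq_uniq //; exact: unroll_inj.
- exact: mem_unrolled_passages.
- move=> s t t' /unrolled_passagesP[u H [_ ->]].
  move=> /unrolled_passagesP[u' H' [_ ->]].
  have [/= Hs Hu su Eu] := H; have [/= _ Hu' su' Eu'] := H'.
  have Euu : g u = g u' by rewrite -Eu.
  by case: (curve_no_triple Hs Hu Hu' Eu Euu) => [/su|->|/su'].
- move=> s t /unrolled_passagesP[u H [_ ->]].
  by case: ifP => _; rewrite ?d1; exact/eqP/(passages_transversal H).
Qed.

End InnerArc.

(** Passages inside the arc cancel in pairs. For the others, an arc through the
    base point is exchanged with its complement by [swap], so that the
    inner one of the two arcs always plays the first role. *)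
Lemma arc_sum u v : passages D (u, v) ->
  \sum_(z <- S | `[< Defs.arc u v z.1 >] && (g z.1 != g u)) passage_sign z = 0.
Proof.
move=> Huv; have [/= Hu Hv uv E] := Huv.
have /andP[u0 u1] := Hu; have /andP[v0 v1] := Hv.
pose K (z : R * R) := `[< Defs.arc u v z.1 >] && (g z.1 != g u).
pose L (z : R * R) := K z && ~~ `[< Defs.arc u v z.2 >].
have other s : circle_pt s -> s <> u -> s <> v -> g s != g u.
  move=> Hs su sv; apply/eqP => Es.
  by case: (double_point_preimages Huv Hs Es).
have notends s : g s != g u -> s != u /\ s != v.
  by move=> H; split; apply: contraNneq H => ->; rewrite ?E.
clear E.
rewrite (bigID (fun z : R * R => `[< Defs.arc u v z.2 >])) /=.
have -> : \sum_(z <- S | K z && `[< Defs.arc u v z.2 >]) passage_sign z = 0.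
  (* The sum equals its own opposite. *)
  set x := LHS; suff : x = - x by lia.
  rewrite {1}/x sum_swap; congr (- _).
  rewrite /x big_seq_cond [RHS]big_seq_cond.
  apply: eq_bigl => z; case: passage_seqP => //= -[_ _ _ Ez].
  rewrite /K /= -Ez andbAC [RHS]andbAC.
  by congr (_ && _); rewrite andbC.
rewrite add0r -/(L _).
move: uv => /eqP; rewrite neq_lt => /orP[uv|vu].
  rewrite -[RHS](inner_arc_sum Huv uv) big_seq_cond [RHS]big_seq_cond.
  apply: eq_bigl => -[s t]; case: passage_seqP => //= -[/= Hs Ht st _].
  have /andP[s0 s1] := Hs; have /andP[t0 t1] := Ht.
  rewrite /L /K /leaves_inner_arc /=; apply/idP/idP.
    move=> /andP[/andP[/asboolP[_ A] N] /asboolPn B].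
    have [su sv] := notends _ N.
    move: A B; rewrite /Defs.arc /= uv => -[us sv'] B.
    rewrite !lt_neqAle us sv' eq_sym su sv /=.
    case: (leP u t) => ut; last by rewrite -lt_neqAle ut.
    case: (leP t v) => tv; last by rewrite -!lt_neqAle tv orbT.
    by case: B.
  move=> /andP[/andP[us sv] B].
  apply/andP; split; first apply/andP; first split.
  - by apply/asboolP; split => //; rewrite uv; split; exact: ltW.
  - by apply: other => // Es; lra.
  - apply/asboolPn => -[_]; rewrite uv => -[ut tv].
    by case/orP: B; lra.
have Hvu : passages D (v, u) := swap_passages Huv.
rewrite sum_swap; apply/eqP; rewrite oppr_eq0; apply/eqP.
rewrite -[RHS](inner_arc_sum Hvu vu) big_seq_cond [RHS]big_seq_cond.
have nuv : (u < v) = false by apply/negbTE; rewrite -leNgt ltW.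
apply: eq_bigl => -[s t]; case: passage_seqP => //= -[/= Hs Ht st _].
have /andP[s0 s1] := Hs; have /andP[t0 t1] := Ht.
rewrite /L /K /leaves_inner_arc /=; apply/idP/idP.
  move=> /andP[/andP[/asboolP[_ A] N] /asboolPn B].
  have [tu tv] := notends _ N.
  move: A; rewrite nuv => A.
  have [us|su] := leP u s; first by case: B; split => //; rewrite nuv; left.
  have [sv|vs] := leP s v; first by case: B; split => //; rewrite nuv; right.
  rewrite /=; case: A => H; apply/orP; [right | left].
    by rewrite lt_neqAle eq_sym tu.
  by rewrite lt_neqAle tv.
move=> /andP[/andP[vs su] B].
apply/andP; split; first apply/andP; first split.
- apply/asboolP; split => //; rewrite nuv.
  by case/orP: B => H; [right | left]; exact: ltW.
- by apply: other => // Et; case/orP: B; lra.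
- by apply/asboolPn => -[_]; rewrite nuv => -[]; lra.
Qed.

Lemma sum_over_passages (A : set (R * R)) (f : R * R -> int) :
  A `<=` passages D ->
  \sum_(z \in A) f z = \sum_(z <- S) if `[< A z >] then f z else 0.
Proof.
move=> AP; rewrite -[A in LHS](setIidr AP) fsbig_mkcondr.
rewrite fsbig_finite; last exact: curve_finite.
by apply: eq_bigr.
Qed.

(** A virtual passage is never at [c], whose two strands are both classical, so
    the condition of being away from [c] can be imposed on all passages. *)
Lemma vInd_sub_Ind (c : classical_crossing D) : vInd c - Ind c =
  \sum_(z <- S | `[< half_plus c z.1 >] && (g z.1 != g (strand_a c)))
    passage_sign z.
Proof.
have P := crossing_passage c; have [/= _ _ _ Eab] := P.
rewrite /vInd /Ind !sum_over_passages; try by move=> z [].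
rewrite -sumrB [RHS]big_mkcond [LHS]big_seq [RHS]big_seq.
apply: eq_bigr => z /passage_seqP Hz.
have d0 := passages_transversal Hz; have [Hz1 _ _ _] := Hz.
have -> : intersection_number D z = - passage_sign z.
  rewrite /intersection_number /left_to_right /passage_sign /frame_sign.
  by move: (det2 _ _) d0 => x; case: ltgtP.
have -> : virtual_number D z = passage_sign z by [].
case: asboolP => [[_ Hh Hv]|nV].
  have nC : ~ classical_passages c z by move=> [_ _].
  rewrite (asboolF nC) subr0 (asboolT Hh) /= ifT //.
  apply/eqP => Ez.
  have ma := @crossing_classical _ _ c; have mb := mark_opposite P.
  case: (double_point_preimages P Hz1 Ez) => Es; rewrite Es in Hv; first by [].
  by move: mb; rewrite Hv; case: (mark D _) ma.
case: asboolP => [[_ Hh Hv Hn]|nC].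
  by rewrite (asboolT Hh) /= (introN eqP Hn) sub0r opprK.
rewrite subr0; case: ifP => // /andP[/asboolP Hh /eqP Hn].
have [Hv|Hv] := pselect (mark D z.1 = Virt); first by case: nV.
by case: nC.
Qed.

End Diagram.

Theorem corollary2 (R : realType) (D : virtual_knot_diagram R)
    (c : classical_crossing D) : vInd c = Ind c.
Proof.
apply/eqP; rewrite -subr_eq0 vInd_sub_Ind; apply/eqP.
have P := crossing_passage c.
rewrite /half_plus; case: ifP => _; last exact: arc_sum.
by have [_ _ _ /= ->] := P; apply: arc_sum; exact: (swap_passages P).
Qed.
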